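(* Let the system $\partial_t\mathbf u+\partial_x\mathbf g(\mathbf u)=0$, with $\mathbf g\in C^2(\mathcal U,\mathbb R^m)$ and $\mathcal U\subset\mathbb R^m$ open, be strictly hyperbolic, let $K\subset\mathcal U$ be convex and compact, and let $\mathbf G$ be the Roe type flux $$\mathbf G(\mathbf a,\mathbf b)=\mathbf g(\mathbf c)+\tfrac12|A|(\mathbf a-\mathbf b),\qquad\mathbf c:=\tfrac12(\mathbf a+\mathbf b),\quad A:=\mathrm D\mathbf g(\mathbf c).$$ Let $\mathbf w(\mathbf a,\mathbf b):=R\,\boldsymbol\omega(\boldsymbol\alpha,\boldsymbol\beta)$ be the smoothed characteristic upwinding defined in the context, and for $\mathbf a\ne\mathbf b$ let $$\mu(\mathbf a,\mathbf b;h):=\frac{\mathbf g(\mathbf w(\mathbf a,\mathbf b))-\mathbf G(\mathbf a,\mathbf b)}{h\,|\mathbf a-\mathbf b|^2}\otimes(\mathbf b-\mathbf a),$$ so that $\mathbf G(\mathbf a,\mathbf b)=\mathbf g(\mathbf w(\mathbf a,\mathbf b))-\mu(\mathbf a,\mathbf b;h)\,h\,(\mathbf b-\mathbf a)$. Then, for every $C_0>0$ there exist $h_0>0$ and $C>0$ such that for all $0<h\le h_0$ and all $\mathbf a,\mathbf b\in K$ with $|\mathbf a-\mathbf b|\le C_0h$ one has $$|\mathbf g(\mathbf w(\mathbf a,\mathbf b))-\mathbf G(\mathbf a,\mathbf b)|\le C\,h\,|\mathbf b-\mathbf a|,$$ so that $\mu$ is bounded as required for the flux $\mathbf G$ to be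 of the form $\mathbf g(\mathbf w(\mathbf a,\mathbf b))-\mu(\mathbf a,\mathbf b;h)h^\nu(\mathbf b-\mathbf a)$ with $\nu=1$ and $|\mu(\mathbf a,\mathbf b;h)|\le\mu_K\left(1+\frac{|\mathbf b-\mathbf a|}{h}\right)$ for some $\mu_K>0$ and $h$ small enough.
   Context: For $\mathbf a,\mathbf b\in K$: strict hyperbolicity means $A=\mathrm D\mathbf g(\mathbf c)$ has $m$ distinct real eigenvalues, and $LAR=D=\mathrm{diag}(\lambda_1,\dots,\lambda_m)$, where $R$ has right eigenvectors $\mathbf r_i$ of $A$ as columns and $L$ has left eigenvectors $\mathbf l_i$ of $A$ as rows, dual to each other: $\mathbf l_i\cdot\mathbf r_j=\delta_{ij}$. Further $|A|:=R\,|D|\,L$ with $|D|:=\mathrm{diag}(|\lambda_1|,\dots,|\lambda_m|)$. The eigenvectors are appropriately normalized so that they are $C^1$ vector fields on $\mathcal U$; in particular $|L|\cdot|R|$ is bounded by a constant depending on $K$ but not on the choice of $\mathbf a,\mathbf b\in K$. Characteristic variables: $\boldsymbol\alpha:=L\mathbf a$, $\boldsymbol\beta:=L\mathbf b$. Let $\chi:\mathbb R\to\mathbb R$ be a (not strictly) monotone smooth function with $\chi(z)=0$ for $z<-1$ and $\chi(z)=1$ for $z>1$, and $\chi_h(z):=\chi(z/h)$. Then $\boldsymbol\omega(\boldsymbol\alpha,\boldsymbol\beta)=(\omega_i(\alpha_i,\beta_i))_{i=1}^m$ with $$\omega_i(\alpha_i,\beta_i)=\chi_h(\lambda_i)\,\alpha_i+(1-\chi_h(\lambda_i))\,\beta_i.$$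 Here $h>0$ is the spatial mesh size; the restriction $|\mathbf a-\mathbf b|\lesssim h$ is a standing assumption of the paper in this argument. For vectors, $(\mathbf x\otimes\mathbf y)\mathbf z=\mathbf x(\mathbf y\cdot\mathbf z)$. *)

(* Defs.v *)
From HB Require Import structures.
From mathcomp Require Import all_boot all_order all_algebra.
From mathcomp Require Import all_classical all_reals all_analysis.
Set Implicit Arguments.
Unset Strict Implicit.
Unset Printing Implicit Defensive.
Import Order.TTheory GRing.Theory Num.Theory.
Import numFieldNormedType.Exports.
Local Open Scope classical_set_scope.
Local Open Scope ring_scope.

(* Euclidean (Frobenius) norm. The library norm on matrices is the max norm,
   for which `|v|^2 = v . v fails; on column vectors this is the Euclidean norm,
   and on rank-one matrices it coincides with the induced operator norm. *)
Definition enorm {R : realType} {m n : nat} (A : 'M[R]_(m, n)) : R :=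
  Num.sqrt (\sum_i \sum_j A i j ^+ 2).

(* C^k regularity on an open set U of a finite-dimensional space, for total
   functions of which only the values on U matter. *)
Fixpoint Ck_on {R : realType} {V W : normedModType R}
    (k : nat) (U : set V) (f : V -> W) : Prop :=
  if k is k'.+1 then
    (forall u, U u -> differentiable f u) /\
    (forall v, Ck_on k' U (fun u => 'D_v f u))
  else forall u, U u -> {for u, continuous f}.

(* Jacobian matrix acting on column vectors; the library's 'J is its transpose
   and acts on row vectors. *)
Definition Dmx {R : realType} {m : nat} (g : 'cV[R]_m -> 'cV[R]_m)
    (u : 'cV[R]_m) : 'M[R]_m :=
  \matrix_(i, j) 'D_(delta_mx j 0) g u i 0.

(* m distinct real eigenvalues at every state (the left and right eigenvalues
   of a square matrix are the same). *)
Definition strictly_hyperbolic {R : realType} {m : nat} (U : set 'cV[R]_m)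
    (g : 'cV[R]_m -> 'cV[R]_m) : Prop :=
  forall u, U u -> exists lambda : 'I_m -> R,
    injective lambda /\ forall i, eigenvalue (Dmx g u) (lambda i).

Record eigenfields (R : realType) (m : nat) := Eigenfields {
  eigval : 'I_m -> 'cV[R]_m -> R;
  revec : 'I_m -> 'cV[R]_m -> 'cV[R]_m;
  levec : 'I_m -> 'cV[R]_m -> 'rV[R]_m
}.

(* For a strictly hyperbolic g, duality makes the r_i a basis, so the
   eigenvalues below are all of the m distinct ones, and L (Dg) R is
   diagonal. *)
Record eigenfields_of {R : realType} {m : nat} (U : set 'cV[R]_m)
    (g : 'cV[R]_m -> 'cV[R]_m) (E : eigenfields R m) : Prop := EigenfieldsOf {
  revecP : forall u i, U u ->
    Dmx g u *m revec E i u = eigval E i u *: revec E i u;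
  levecP : forall u i, U u ->
    levec E i u *m Dmx g u = eigval E i u *: levec E i u;
  dualP : forall u i j, U u ->
    (levec E i u *m revec E j u) 0 0 = (i == j)%:R;
  revecC1 : forall i, Ck_on 1 U (revec E i);
  levecC1 : forall i, Ck_on 1 U (levec E i)
}.

Definition Rmx {R : realType} {m : nat} (E : eigenfields R m)
    (u : 'cV[R]_m) : 'M[R]_m := \matrix_(i, j) revec E j u i 0.

Definition Lmx {R : realType} {m : nat} (E : eigenfields R m)
    (u : 'cV[R]_m) : 'M[R]_m := \matrix_(i, j) levec E i u 0 j.

Definition absmx {R : realType} {m : nat} (E : eigenfields R m)
    (u : 'cV[R]_m) : 'M[R]_m :=
  Rmx E u *m diag_mx (\row_i `|eigval E i u|) *m Lmx E u.

Definition midpt {R : realType} {m : nat} (a b : 'cV[R]_m) : 'cV[R]_m :=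
  2^-1 *: (a + b).

Definition roe_flux {R : realType} {m : nat} (g : 'cV[R]_m -> 'cV[R]_m)
    (E : eigenfields R m) (a b : 'cV[R]_m) : 'cV[R]_m :=
  g (midpt a b) + 2^-1 *: (absmx E (midpt a b) *m (a - b)).

Record smooth_switch {R : realType} (chi : R -> R) : Prop := SmoothSwitch {
  switch_mono : nondecreasing_fun chi;
  switch_smooth : forall n (x : R), derivable (derive1n n chi) x 1;
  switch_left : forall z : R, z < -1 -> chi z = 0;
  switch_right : forall z : R, 1 < z -> chi z = 1
}.

Definition upwind_char {R : realType} {m : nat} (chi : R -> R) (h : R)
    (lambda : 'I_m -> R) (alpha beta : 'cV[R]_m) : 'cV[R]_m :=
  \col_i (chi (lambda i / h) * alpha i 0
          + (1 - chi (lambda i / h)) * beta i 0).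

Definition upwind {R : realType} {m : nat} (E : eigenfields R m)
    (chi : R -> R) (h : R) (a b : 'cV[R]_m) : 'cV[R]_m :=
  let c := midpt a b in
  Rmx E c *m upwind_char chi h (eigval E ^~ c) (Lmx E c *m a) (Lmx E c *m b).

(* (x (x) y) z = x (y . z) *)
Definition tensor {R : realType} {m : nat} (x y : 'cV[R]_m) : 'M[R]_m :=
  x *m y^T.

(* Meaningful for a != b only. *)
Definition roe_mu {R : realType} {m : nat} (g : 'cV[R]_m -> 'cV[R]_m)
    (E : eigenfields R m) (chi : R -> R) (h : R) (a b : 'cV[R]_m) : 'M[R]_m :=
  tensor ((h * enorm (a - b) ^+ 2)^-1
            *: (g (upwind E chi h a b) - roe_flux g E a b))
         (b - a).

(* Main.v *)
Require Import Defs.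
From HB Require Import structures.
From mathcomp Require Import all_boot all_order all_algebra.
From mathcomp Require Import all_classical all_reals all_analysis.
From mathcomp Require Import ring lra.
Import Order.TTheory GRing.Theory Num.Theory.
Import numFieldNormedType.Exports.
Local Open Scope classical_set_scope.
Local Open Scope ring_scope.

(** Write c for the midpoint, d := a - b, and S(s) := R diag(s) L for the
    eigenvectors taken at c. Since R L = 1, splitting a and b as c + d/2 and
    c - d/2 gives w = c + v with v = S(chi_h(lambda) - 1/2) d (upwindE), and
    Dg(c) S(s) = S(lambda s) (Dmx_spectral). Hence
      g(w) - G = (g(c + v) - g(c) - Dg(c) v)
                 + S(lambda (chi_h(lambda) - 1/2) - |lambda| / 2) d.
    In the second term the scalar factor vanishes as soon as |lambda| > h,
    because chi_h then is exactly 0 or 1 and the smoothed upwinding is the sharp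
    one; when |lambda| <= h it is at most |lambda|, so it never exceeds h
    (switch_defect). The second term is therefore O(h |d|). The first term is a
    Taylor remainder, O(|v|^2) = O(|d|^2), which is O(h |d|) because
    |d| <= C0 h.

    The constants must be uniform in a and b. The midpoint stays in K, and the
    needed bounds hold near every point of K, hence on K (compact_uniform): the
    eigenbasis is bounded since it is continuous, and the Taylor estimate near a
    point of U follows from two applications of the mean value theorem
    (locally_taylor). Intermediate estimates use the library norm on matrices,
    the maximum of the absolute values of the entries, which is compared with the
    Euclidean norm only at the end. *)

(** * Maximum norm and Euclidean norm of matrices *)

Section Norms.
Context {R : realType}.

Lemma mx_entry_le {m n : nat} (A : 'M[R]_(m, n)) i j : `|A i j| <= `|A|.
Proof.
rewrite [leRHS]/Num.Def.normr/= mx_normrE.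
exact: (le_bigmax _ (fun ij : 'I_m * 'I_n => `|A ij.1 ij.2|) (i, j)).
Qed.

Lemma mx_norm_le {m n : nat} (A : 'M[R]_(m, n)) (B : R) :
  0 <= B -> (forall i j, `|A i j| <= B) -> `|A| <= B.
Proof.
move=> B0 AB; rewrite [leLHS]/Num.Def.normr/= mx_normrE.
by apply: bigmax_le => // -[i j] _; exact: AB.
Qed.

Lemma mulmx_norm_le {m n p : nat} (A : 'M[R]_(m, n)) (B : 'M[R]_(n, p)) :
  `|A *m B| <= n%:R * (`|A| * `|B|).
Proof.
apply: mx_norm_le => [|i j]; first by rewrite !mulr_ge0.
rewrite mxE (le_trans (ler_norm_sum _ _ _))//.
have -> : n%:R * (`|A| * `|B|) = \sum_(k < n) (`|A| * `|B|).
  by rewrite sumr_const card_ord mulr_natl.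
by apply: ler_sum => k _; rewrite normrM ler_pM ?mx_entry_le.
Qed.

Lemma diag_mx_norm_le {n : nat} (s : 'I_n -> R) (B : R) :
  0 <= B -> (forall i, `|s i| <= B) -> `|diag_mx (\row_i s i)| <= B.
Proof.
move=> B0 sB; apply: mx_norm_le => // i j; rewrite !mxE.
by case: eqVneq => [->|_]; rewrite ?mulr1n// mulr0n normr0.
Qed.

Lemma enorm_ge0 {m n : nat} (A : 'M[R]_(m, n)) : 0 <= enorm A.
Proof. exact: sqrtr_ge0. Qed.

Lemma sqr_enorm {m n : nat} (A : 'M[R]_(m, n)) :
  enorm A ^+ 2 = \sum_i \sum_j A i j ^+ 2.
Proof.
rewrite sqr_sqrtr// sumr_ge0// => i _; rewrite sumr_ge0// => j _.
exact: sqr_ge0.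
Qed.

Lemma norm_le_enorm {m n : nat} (A : 'M[R]_(m, n)) : `|A| <= enorm A.
Proof.
apply: mx_norm_le => [|i j]; first exact: enorm_ge0.
rewrite -(ler_pXn2r (ltn0Sn 1)) ?nnegrE ?enorm_ge0// sqr_enorm.
rewrite real_normK ?num_real// (bigD1 i)//= (bigD1 j)//= -addrA lerDl.
rewrite addr_ge0// !sumr_ge0// => k _; first exact: sqr_ge0.
by rewrite sumr_ge0// => l _; exact: sqr_ge0.
Qed.

Lemma enorm_le_norm {m n : nat} (A : 'M[R]_(m, n)) :
  enorm A <= (m * n)%:R * `|A|.
Proof.
rewrite -(ler_pXn2r (ltn0Sn 1)) ?nnegrE ?enorm_ge0 ?mulr_ge0//.
rewrite sqr_enorm exprMn.
have le1 : \sum_i \sum_j A i j ^+ 2 <= \sum_(i < m) \sum_(j < n) `|A| ^+ 2.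
  apply: ler_sum => i _; apply: ler_sum => j _.
  rewrite -real_normK ?num_real//.
  by rewrite ler_pXn2r ?nnegrE ?mx_entry_le.
apply: (le_trans le1).
rewrite !sumr_const !card_ord -mulrnA mulnC -[leLHS]mulr_natl.
rewrite ler_wpM2r ?sqr_ge0// -natrX ler_nat -mulnn.
by case: (m * n)%N => // k; rewrite leq_pmulr.
Qed.

Lemma enorm_gt0 {m n : nat} (A : 'M[R]_(m, n)) : A != 0 -> 0 < enorm A.
Proof. by rewrite -normr_gt0 => /lt_le_trans; apply; exact: norm_le_enorm. Qed.

Lemma enormN {m n : nat} (A : 'M[R]_(m, n)) : enorm (- A) = enorm A.
Proof.
rewrite /enorm; congr Num.sqrt.
by apply: eq_bigr => i _; apply: eq_bigr => j _; rewrite mxE sqrrN.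
Qed.

Lemma enormB {m n : nat} (A B : 'M[R]_(m, n)) : enorm (A - B) = enorm (B - A).
Proof. by rewrite -enormN opprB. Qed.

Lemma enormZ {m n : nat} (k : R) (A : 'M[R]_(m, n)) :
  enorm (k *: A) = `|k| * enorm A.
Proof.
rewrite /enorm -sqrtr_sqr -sqrtrM ?sqr_ge0//; congr Num.sqrt.
rewrite mulr_sumr; apply: eq_bigr => i _; rewrite mulr_sumr.
by apply: eq_bigr => j _; rewrite mxE exprMn.
Qed.

Lemma dotmxx {m : nat} (y : 'cV[R]_m) : y^T *m y = (enorm y ^+ 2)%:M.
Proof.
apply/matrixP => i j; rewrite !ord1 !mxE eqxx mulr1n sqr_enorm.
by apply: eq_bigr => k _; rewrite big_ord1 !mxE -expr2.
Qed.

Lemma tensorE {m : nat} (x y : 'cV[R]_m) :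
  tensor x y *m y = enorm y ^+ 2 *: x.
Proof. by rewrite /tensor -mulmxA dotmxx mul_mx_scalar. Qed.

Lemma enorm_tensor {m : nat} (x y : 'cV[R]_m) :
  enorm (tensor x y) = enorm x * enorm y.
Proof.
rewrite /enorm -sqrtrM; last first.
  by rewrite !sumr_ge0// => i _; rewrite sumr_ge0// => j _; rewrite sqr_ge0.
congr Num.sqrt; rewrite mulr_suml; apply: eq_bigr => i _.
rewrite big_ord1 mulr_sumr; apply: eq_bigr => j _.
by rewrite /tensor mxE !big_ord1 mxE exprMn.
Qed.

End Norms.

(** * Mean value theorem and directional derivatives *)

Section Calculus.
Context {R : realType}.

Lemma derivative_along_line {V : normedModType R} {n : nat}
    {f : V -> 'cV[R]_n} {x v : V} {t : R} (i : 'I_n) :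
  differentiable f (x + t *: v) ->
  is_derive t 1 (fun s => f (x + s *: v) i 0) (('D_v f (x + t *: v)) i 0).
Proof.
move=> df.
have dv : derivable f (x + t *: v) v by exact: diff_derivable.
have dc : derivable (fun y => f y i 0) (x + t *: v) v.
  by move/derivable_mxP : dv => /(_ i 0).
have E h : (h *: v + (x + t *: v)) = x + (h + t) *: v.
  by rewrite scalerDl addrCA addrA.
have -> : ('D_v f (x + t *: v)) i 0 = 'D_v (fun y => f y i 0) (x + t *: v).
  by rewrite derive_mx// mxE.
have F : (fun h => h^-1 *: (((fun y => f y i 0) \o shift (x + t *: v)) (h *: v)
             - f (x + t *: v) i 0)) =
         (fun h => h^-1 *: (((fun s => f (x + s *: v) i 0) \o shift t) (h *: (1 : R))
             - f (x + t *: v) i 0)).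
  by apply/funext => h /=; rewrite E /GRing.scale/= mulr1.
by split; [move: dc; rewrite /derivable F|rewrite /derive F].
Qed.

(** The intermediate point t depends on the coordinate i, which is why the
    equality is stated for one coordinate at a time. *)
Lemma mean_value_along_segment {V : normedModType R} {n : nat}
    {f : V -> 'cV[R]_n} {x v : V} (i : 'I_n) :
  (forall t : R, 0 <= t <= 1 -> differentiable f (x + t *: v)) ->
  exists2 t : R, 0 <= t <= 1 &
    f (x + v) i 0 - f x i 0 = ('D_v f (x + t *: v)) i 0.
Proof.
move=> df; pose phi s := f (x + s *: v) i 0.
have dphi (t : R) : 0 <= t <= 1 -> is_derive t 1 phi (('D_v f (x + t *: v)) i 0).
  by move=> t01; apply: derivative_along_line; exact: df.
have phi01 (t : R) : t \in `]0, 1[%R -> is_derive t 1 phi (('D_v f (x + t *: v)) i 0).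
  by rewrite in_itv/= => /andP[t0 t1]; apply: dphi; rewrite !ltW.
have cphi : {within `[0, 1], continuous phi}.
  apply: derivable_within_continuous => t; rewrite in_itv/= => /dphi t01.
  exact: ex_derive.
have [t] := MVT_segment ler01 phi01 cphi.
rewrite in_itv/= => t01; rewrite /phi scale1r scale0r addr0 subr0 mulr1 => E.
by exists t.
Qed.

Lemma segment_in_ball {V : normedModType R} {c x v : V} {r t : R} :
  ball c r x -> ball c r (x + v) -> 0 <= t <= 1 -> ball c r (x + t *: v).
Proof.
rewrite -!ball_normE/= => cx cxv /andP[t0 t1].
have -> : c - (x + t *: v) = (1 - t) *: (c - x) + t *: (c - (x + v)).
  by rewrite !opprD !addrA scalerBl scale1r [t *: (_ - v)]scalerBr addrA subrK.
apply: (le_lt_trans (ler_normD _ _)); rewrite !normrZ.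
rewrite (ger0_norm t0) ger0_norm ?subr_ge0//.
have [->|tn0] := eqVneq t 0; first by rewrite mul0r subr0 mul1r addr0.
have tp : 0 < t by rewrite lt_neqAle eq_sym tn0.
rewrite [ltRHS](_ : r = (1 - t) * r + t * r); last by ring.
by rewrite ler_ltD ?ltr_pM2l// ler_wpM2l ?subr_ge0// ltW.
Qed.

Lemma derive_coord {m : nat} {W : normedModType R} {f : 'cV[R]_m -> W}
    {x : 'cV[R]_m} (v : 'cV[R]_m) :
  differentiable f x ->
  'D_v f x = \sum_j v j 0 *: 'D_(delta_mx j 0) f x.
Proof.
move=> df; rewrite deriveE// {1}(matrix_sum_delta v) linear_sum.
apply: eq_bigr => j _; rewrite big_ord1 linearZ/=.
by rewrite deriveE.
Qed.

Lemma DmxE {m : nat} {g : 'cV[R]_m -> 'cV[R]_m} {u : 'cV[R]_m} (v : 'cV[R]_m) :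
  differentiable g u -> Dmx g u *m v = 'D_v g u.
Proof.
move=> dg; rewrite (derive_coord v dg); apply/colP => i.
rewrite mxE summxE; apply: eq_bigr => j _.
by rewrite !mxE mulrC.
Qed.

End Calculus.

(** * Local estimates and their uniformity on compact sets *)

(** The local estimates below share one small parameter e, both as a radius and,
    through its inverse, as a constant. They hold for all sufficiently small e > 0,
    so finitely many of them share an e, and on a compact set the radius and the
    constant become uniform at the same time. *)
Section LocalEstimates.
Context {R : realType}.

Lemma inv_large (B : R) : \forall e \near 0^'+, B <= e^-1.
Proof.
near=> e.
have e0 : 0 < e by near: e; exact: nbhs_right_gt.
have p : 0 < `|B| + 1 by rewrite ltr_wpDl.
apply: (le_trans (ler_norm B)); apply: (@le_trans _ _ (`|B| + 1)).
  by rewrite lerDl.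
rewrite -[leLHS]invrK lef_pV2 ?posrE ?invr_gt0//.
by apply: ltW; near: e; apply: nbhs_right_lt; rewrite invr_gt0.
Unshelve. all: by end_near. Qed.

Lemma ball_sub_open {V : normedModType R} {U : set V} {c : V} :
  open U -> U c -> \forall e \near (0 : R)^'+, ball c e `<=` U.
Proof.
move=> oU Uc; have /nbhs_ballP[r /= r0 rU] := open_nbhs_nbhs (conj oU Uc).
near=> e; apply: subset_trans rU; apply: le_ball.
by apply: ltW; near: e; exact: nbhs_right_lt.
Unshelve. all: by end_near. Qed.

Lemma locally_bounded {V W : normedModType R} {f : V -> W} {c : V} :
  {for c, continuous f} -> \forall e \near (0 : R)^'+,
  forall x, ball c e x -> `|f x| <= e^-1.
Proof.
move=> cf; have : \forall x \near c, `|f x| <= `|f c| + 1.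
  have /cvgr_dist_le/(_ _ ltr01) := cf; apply: filterS => x.
  by rewrite -lerBlDl; apply: le_trans; rewrite distrC lerB_dist.
move=> /nbhs_ballP[r /= r0 rf]; near=> e => x ce.
apply: (@le_trans _ _ (`|f c| + 1)).
  apply/rf/(le_ball _ ce).
  by apply: ltW; near: e; exact: nbhs_right_lt.
by near: e; exact: inv_large.
Unshelve. all: by end_near. Qed.

(** Near c the partial derivatives are bounded, so by the mean value theorem on
    segments of a ball f is Lipschitz there. *)
Lemma locally_lipschitz {m n : nat} {U : set 'cV[R]_m}
    {f : 'cV[R]_m -> 'cV[R]_n} {c : 'cV[R]_m} :
  open U -> Ck_on 1 U f -> U c -> \forall e \near (0 : R)^'+,
  forall x v, ball c e x -> ball c e (x + v) ->
    `|f (x + v) - f x| <= e^-1 * `|v|.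
Proof.
move=> oU [df cDf] Uc.
have Dbd : \forall e \near (0 : R)^'+, forall j x, ball c e x ->
    `|'D_(delta_mx j 0) f x| <= e^-1.
  apply: filter_forall => j.
  exact: (@locally_bounded _ _ ('D_(delta_mx j 0) f) _ (cDf _ _ Uc)).
have rU := ball_sub_open oU Uc.
have /filter_ex[r [r0 [rD {}rU]]] :
  \forall r \near (0 : R)^'+, 0 < r /\
    ((forall j x, ball c r x -> `|'D_(delta_mx j 0) f x| <= r^-1) /\
    ball c r `<=` U).
  near=> r; split; last split; near: r => //.
  exact: nbhs_right_gt.
near=> e => x v xe xve.
have er : e <= r by apply: ltW; near: e; exact: nbhs_right_lt.
have e0 : 0 < e by near: e; exact: nbhs_right_gt.
have inr (t : R) : 0 <= t <= 1 -> ball c r (x + t *: v).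
  by move=> t01; exact: (le_ball er (segment_in_ball xe xve t01)).
apply: mx_norm_le => [|i j]; first by rewrite mulr_ge0// invr_ge0 ltW.
rewrite !mxE (ord1 j).
have [|t t01 ->] := mean_value_along_segment i (f := f) (x := x) (v := v).
  by move=> t t01; exact/df/rU/inr.
rewrite (le_trans (mx_entry_le _ _ _))// derive_coord; last exact/df/rU/inr.
rewrite (le_trans (ler_norm_sum _ _ _))//.
apply: (@le_trans _ _ (\sum_(k < m) (r^-1 * `|v|))).
  apply: ler_sum => k _; rewrite normrZ mulrC ler_pM ?mx_entry_le//.
  exact/rD/inr.
rewrite sumr_const card_ord -mulrnAl ler_wpM2r//.
by near: e; exact: inv_large.
Unshelve. all: by end_near. Qed.

(** The i-th coordinate of g (x + v) - g x equals that of 'D_v g (x + t *: v) for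
    some t between 0 and 1, and 'D_v g moves by O(|v|^2) from x to x + t *: v
    because it is the combination with coefficients v_j of the partial
    derivatives, which are locally Lipschitz. *)
Lemma locally_taylor {m n : nat} {U : set 'cV[R]_m}
    {g : 'cV[R]_m -> 'cV[R]_n} {c : 'cV[R]_m} :
  open U -> Ck_on 2 U g -> U c -> \forall e \near (0 : R)^'+,
  forall x v, ball c e x -> `|v| < e ->
    U (x + v) /\ `|g (x + v) - g x - 'D_v g x| <= e^-1 * `|v| ^+ 2.
Proof.
move=> oU [dg C1Dg] Uc.
have DL : \forall e \near (0 : R)^'+, forall j x v,
    ball c e x -> ball c e (x + v) ->
    `|'D_(delta_mx j 0) g (x + v) - 'D_(delta_mx j 0) g x| <= e^-1 * `|v|.
  apply: filter_forall => j; exact: locally_lipschitz oU (C1Dg _) Uc.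
have rU := ball_sub_open oU Uc.
have /filter_ex[r [r0 [rD {}rU]]] :
  \forall r \near (0 : R)^'+, 0 < r /\
    ((forall j x v, ball c r x -> ball c r (x + v) ->
    `|'D_(delta_mx j 0) g (x + v) - 'D_(delta_mx j 0) g x| <= r^-1 * `|v|) /\
    ball c r `<=` U).
  near=> r; split; last split; near: r => //.
  exact: nbhs_right_gt.
near=> e => x v xe ve.
have er : e <= r / 2 by apply: ltW; near: e; apply: nbhs_right_lt; rewrite divr_gt0.
have e0 : 0 < e by near: e; exact: nbhs_right_gt.
have xr : ball c r x by apply: le_ball xe; lra.
have xvr : ball c r (x + v).
  move: xe; rewrite -!ball_normE/= opprD addrA => xe.
  by rewrite (le_lt_trans (ler_normB _ _))//; lra.
split; first exact: rU.
have inr (t : R) : 0 <= t <= 1 -> ball c r (x + t *: v) := segment_in_ball xr xvr.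
apply: mx_norm_le => [|i j].
  by rewrite mulr_ge0 ?invr_ge0 ?sqr_ge0// ltW.
have [|t t01 E] := mean_value_along_segment i (f := g) (x := x) (v := v).
  by move=> t t01; exact/dg/rU/inr.
have -> : (g (x + v) - g x - 'D_v g x) i j =
    ('D_v g (x + t *: v) - 'D_v g x) i 0.
  by rewrite (ord1 j) !mxE E.
rewrite (le_trans (mx_entry_le _ _ _))//.
rewrite (derive_coord v (dg _ (rU _ xr))) (derive_coord v (dg _ (rU _ (inr _ t01)))).
rewrite -sumrB (le_trans (ler_norm_sum _ _ _))//.
apply: (@le_trans _ _ (\sum_(k < m) (r^-1 * `|v| ^+ 2))).
  apply: ler_sum => k _; rewrite -scalerBr normrZ.
  rewrite expr2 mulrCA ler_pM ?mx_entry_le//.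
  rewrite (le_trans (rD k _ _ xr (inr _ t01)))// ler_wpM2l ?invr_ge0 ?(ltW r0)//.
  rewrite normrZ; case/andP: t01 => t0 t1.
  by rewrite (ger0_norm t0) ler_piMl.
rewrite sumr_const card_ord -mulrnAl ler_wpM2r ?sqr_ge0//.
by near: e; exact: inv_large.
Unshelve. all: by end_near. Qed.

(** A fixed ball of radius r on which the property holds with parameter r is a
    neighbourhood on which, by monotonicity, it holds for all smaller
    parameters; compactness then allows a common one. *)
Lemma compact_uniform {V : normedModType R} {K : set V} {P : R -> V -> Prop} :
  (forall e e' x, 0 < e' -> e' <= e -> P e x -> P e' x) ->
  compact K ->
  (forall c, K c -> \forall e \near (0 : R)^'+, forall x, ball c e x -> P e x) ->
  \forall e \near (0 : R)^'+, forall x, K x -> P e x.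
Proof.
move=> Pmono /compact_near_coveringP cK locP.
apply: (cK R (0 : R)^'+ P) => c /locP Pc.
have /filter_ex[r [r0 Pr]] : \forall r \near (0 : R)^'+,
    0 < r /\ forall x, ball c r x -> P r x.
  by near=> r; split; near: r => //; exact: nbhs_right_gt.
exists (ball c r, [set e | 0 < e < r]) => [|[x e] /= [cx /andP[e0 er]]].
  split => /=; first exact: nbhsx_ballx.
  by near=> e; apply/andP; split; near: e;
    [exact: nbhs_right_gt|exact: nbhs_right_lt].
exact: (Pmono r e x e0 (ltW er) (Pr x cx)).
Unshelve. all: by end_near. Qed.

Lemma bounded_on_compact {V W : normedModType R} {f : V -> W} {K : set V} :
  compact K -> (forall c, K c -> {for c, continuous f}) ->
  \forall e \near (0 : R)^'+, forall c, K c -> `|f c| <= e^-1.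
Proof.
move=> cK cf; apply: compact_uniform => //.
  move=> e e' x e'0 e'e /le_trans; apply.
  by rewrite lef_pV2 ?posrE// (lt_le_trans e'0).
by move=> c Kc; apply: locally_bounded; exact: cf.
Qed.

Lemma uniform_taylor {m n : nat} {U K : set 'cV[R]_m}
    {g : 'cV[R]_m -> 'cV[R]_n} :
  open U -> Ck_on 2 U g -> compact K -> K `<=` U ->
  \forall e \near (0 : R)^'+, forall c, K c -> forall v, `|v| < e ->
    U (c + v) /\ `|g (c + v) - g c - 'D_v g c| <= e^-1 * `|v| ^+ 2.
Proof.
move=> oU gC2 cK KU; apply: compact_uniform => //.
  move=> e e' x e'0 e'e P v ve'; have [|Uxv le1] := P v; first exact: lt_le_trans e'e.
  split=> //; apply: (le_trans le1); rewrite ler_wpM2r ?sqr_ge0//.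
  by rewrite lef_pV2 ?posrE// (lt_le_trans e'0).
move=> c Kc; have := locally_taylor oU gC2 (KU _ Kc).
by apply: filterS => e P x xe v ve; exact: P.
Qed.

End LocalEstimates.

(** * Matrices diagonal in the eigenbasis *)

(** The Jacobian, its absolute value and the operator that maps a - b to the
    offset of the upwind state from the midpoint are all of this form, with s
    equal to lambda, |lambda| and chi_h(lambda) - 1/2. *)
Definition spectral_mx {R : realType} {m : nat} (E : eigenfields R m)
    (u : 'cV[R]_m) (s : 'I_m -> R) : 'M[R]_m :=
  Rmx E u *m diag_mx (\row_i s i) *m Lmx E u.

Section Spectral.
Context {R : realType} {m : nat} {U : set 'cV[R]_m}.
Context {g : 'cV[R]_m -> 'cV[R]_m} {E : eigenfields R m}.
Context (eigE : eigenfields_of U g E).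

Lemma mul_Rmx_Lmx {u : 'cV[R]_m} : U u -> Rmx E u *m Lmx E u = 1%:M.
Proof.
move=> Uu; apply: mulmx1C; apply/matrixP => i j.
rewrite -[RHS]/((1%:M : 'M[R]_m) i j) [RHS]mxE -(dualP eigE i j Uu) !mxE.
by apply: eq_bigr => k _; rewrite !mxE.
Qed.

(** The columns of R are eigenvectors, that is Dg R = R diag(lambda). *)
Lemma Dmx_spectral {u : 'cV[R]_m} (s : 'I_m -> R) : U u ->
  Dmx g u *m spectral_mx E u s = spectral_mx E u (fun i => eigval E i u * s i).
Proof.
move=> Uu; rewrite /spectral_mx !mulmxA; congr (_ *m _).
have -> : Dmx g u *m Rmx E u = Rmx E u *m diag_mx (\row_i eigval E i u).
  rewrite mul_mx_diag; apply/matrixP => i j.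
  have /matrixP/(_ i 0) := revecP eigE j Uu.
  rewrite !mxE mulrC => <-.
  by apply: eq_bigr => k _; rewrite !mxE.
rewrite -mulmxA; congr (_ *m _).
rewrite mul_diag_mx; apply/matrixP => i j; rewrite !mxE.
by case: eqVneq => [->|_]; rewrite ?mulr1n// !mulr0n mulr0.
Qed.

(** With alpha = L a and beta = L b,
    chi alpha + (1 - chi) beta = (alpha + beta) / 2 + (chi - 1/2) (alpha - beta),
    and R maps (alpha + beta) / 2 = L c back to c. *)
Lemma upwindE (chi : R -> R) (h : R) (a b : 'cV[R]_m) : U (midpt a b) ->
  upwind E chi h a b = midpt a b +
    spectral_mx E (midpt a b)
      (fun i => chi (eigval E i (midpt a b) / h) - 2^-1) *m (a - b).
Proof.
move=> Uc; rewrite /upwind; set c := midpt a b.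
rewrite -[X in X + _]mul1mx -(mul_Rmx_Lmx Uc) /spectral_mx -!mulmxA -mulmxDr.
congr (_ *m _).
have -> : Lmx E c *m c = 2^-1 *: (Lmx E c *m a + Lmx E c *m b).
  by rewrite -mulmxDr scalemxAr.
rewrite mulmxBr; move: (Lmx E c *m a) (Lmx E c *m b) => alpha beta.
rewrite mul_diag_mx; apply/colP => i; rewrite !mxE.
by field.
Qed.

End Spectral.

Section SpectralNorm.
Context {R : realType} {m : nat} {E : eigenfields R m}.

Lemma norm_spectral_le {u d : 'cV[R]_m} {s : 'I_m -> R} {M B : R} :
  0 <= B -> `|Rmx E u| <= M -> `|Lmx E u| <= M -> (forall i, `|s i| <= B) ->
  `|spectral_mx E u s *m d| <= m%:R ^+ 3 * M ^+ 2 * B * `|d|.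
Proof.
move=> B0 RM LM sB; have M0 : 0 <= M by apply: le_trans RM.
rewrite /spectral_mx -mulmxA.
apply: (le_trans (mulmx_norm_le _ _)).
have le1 : `|Rmx E u *m diag_mx (\row_i s i)| <= m%:R * (M * B).
  apply: (le_trans (mulmx_norm_le _ _)).
  by rewrite ler_wpM2l// ler_pM// diag_mx_norm_le.
have le2 : `|Lmx E u *m d| <= m%:R * (M * `|d|).
  apply: (le_trans (mulmx_norm_le _ _)).
  by rewrite ler_wpM2l// ler_wpM2r.
have := ler_pM (normr_ge0 _) (normr_ge0 _) le1 le2.
move=> /(ler_wpM2l (ler0n R m)) /le_trans; apply.
by rewrite le_eqVlt (_ : _ == _)//; apply/eqP; ring.
Qed.

Lemma eigenbasis_bounded {U K : set 'cV[R]_m} {g : 'cV[R]_m -> 'cV[R]_m} :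
  eigenfields_of U g E -> K `<=` U -> compact K ->
  \forall e \near (0 : R)^'+, forall c, K c ->
    `|Rmx E c| <= e^-1 /\ `|Lmx E c| <= e^-1.
Proof.
move=> eigE KU cK.
have bR : \forall e \near (0 : R)^'+, forall j c, K c -> `|revec E j c| <= e^-1.
  apply: filter_forall => j; apply: bounded_on_compact => // c Kc.
  by apply: differentiable_continuous; apply: (revecC1 eigE j).1; exact: KU.
have bL : \forall e \near (0 : R)^'+, forall j c, K c -> `|levec E j c| <= e^-1.
  apply: filter_forall => j; apply: bounded_on_compact => // c Kc.
  by apply: differentiable_continuous; apply: (levecC1 eigE j).1; exact: KU.
near=> e => c Kc.
have e0 : 0 <= e^-1 by rewrite invr_ge0 ltW//; near: e; exact: nbhs_right_gt.
split; apply: mx_norm_le => // i j; rewrite mxE.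
  apply: (le_trans (mx_entry_le _ _ _)); move: j c Kc; near: e; exact: bR.
apply: (le_trans (mx_entry_le _ _ _)); move: i c Kc; near: e; exact: bL.
Unshelve. all: by end_near. Qed.

End SpectralNorm.

(** * The smoothed switch *)

Section Switch.
Context {R : realType} {chi : R -> R}.
Context (chiP : smooth_switch chi).

Lemma switch_01 (z : R) : 0 <= chi z <= 1.
Proof.
apply/andP; split.
- have lt1 : Num.min z (-2) < -1 :> R by rewrite gt_min; apply/orP; right; lra.
  rewrite -(switch_left chiP lt1); apply: (switch_mono chiP).
  by rewrite ge_min lexx.
- have gt1 : 1 < Num.max z 2 :> R by rewrite lt_max; apply/orP; right; lra.
  rewrite -(switch_right chiP gt1); apply: (switch_mono chiP).
  by rewrite le_max lexx.
Qed.

Lemma switch_sub_half (z : R) : `|chi z - 2^-1| <= 1.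
Proof. by rewrite ler_norml; have /andP[] := switch_01 z; lra. Qed.

(** For |l| > h the switch is saturated and l (chi - 1/2) = |l| / 2 exactly; for |l| <= h both
    terms are at most |l| / 2 in absolute value. *)
Lemma switch_defect (h l : R) : 0 < h ->
  `|l * (chi (l / h) - 2^-1) - 2^-1 * `|l| | <= h.
Proof.
move=> h0; have [lh|hl] := leP `|l| h.
  have /andP[c0 c1] := switch_01 (l / h).
  have le1 : `|l * (chi (l / h) - 2^-1)| <= 2^-1 * `|l|.
    by rewrite normrM mulrC ler_wpM2r// ler_norml; lra.
  apply: (le_trans (ler_normB _ _)).
  rewrite [X in _ + X]ger0_norm ?mulr_ge0//; lra.
rewrite (_ : _ - _ = 0) ?normr0 ?ltW//.
have [l0|l0] := leP 0 l.
  have lh : 1 < l / h by rewrite ltr_pdivlMr// mul1r -(ger0_norm l0).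
  by rewrite (switch_right chiP lh) (ger0_norm l0); field.
have lh : l / h < -1 by rewrite ltr_pdivrMr// mulN1r ltrNr -(ltr0_norm l0).
by rewrite (switch_left chiP lh) (ltr0_norm l0); field.
Qed.

End Switch.

(** * Error of the upwind state and the coefficient mu *)

Lemma convex_midpt {R : realType} {m : nat} {K : set 'cV[R]_m}
    {a b : 'cV[R]_m} :
  convex_set K -> K a -> K b -> K (midpt a b).
Proof.
move=> cK Ka Kb.
have h0 : 0 <= 2^-1 :> R by rewrite invr_ge0.
have h1 : 2^-1 <= 1 :> R by rewrite invf_le1 ?ler1n.
have := cK a b (Itv01 h0 h1); rewrite !inE => /(_ Ka Kb).
have half : 1 - 2^-1 = 2^-1 :> R by field.
by rewrite /conv/= /unstable.onem half -scalerDr.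
Qed.

Lemma upwind_error {R : realType} {m : nat}
    {U : set 'cV[R]_m} {g : 'cV[R]_m -> 'cV[R]_m} {K : set 'cV[R]_m}
    {E : eigenfields R m} {chi : R -> R} :
  open U -> Ck_on 2 U g -> K `<=` U -> convex_set K -> compact K ->
  eigenfields_of U g E -> smooth_switch chi ->
  forall C0 : R, 0 < C0 -> exists h0 C : R, [/\ 0 < h0, 0 < C &
    forall (h : R) (a b : 'cV[R]_m),
      0 < h -> h <= h0 -> K a -> K b -> enorm (a - b) <= C0 * h ->
      U (upwind E chi h a b) /\
      enorm (g (upwind E chi h a b) - roe_flux g E a b)
        <= C * h * enorm (b - a)].
Proof.
move=> openU gC2 KU convK compK eigE chiP C0 C0_gt0.
have [e [e0 [eT eB]]] : exists e : R, 0 < e /\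
    ((forall c, K c -> forall v, `|v| < e ->
      U (c + v) /\ `|g (c + v) - g c - 'D_v g c| <= e^-1 * `|v| ^+ 2) /\
    (forall c, K c -> `|Rmx E c| <= e^-1 /\ `|Lmx E c| <= e^-1)).
  apply: (@filter_ex _ ((0 : R)^'+)); near=> e.
  split; first by near: e; exact: nbhs_right_gt.
  split; near: e; first exact: uniform_taylor compK KU.
  exact: eigenbasis_bounded eigE KU compK.
(* Q bounds the size of S(s) for |s| <= 1; the summand 1 makes it positive
   also in dimension 0, like the summand 1 in the constant m k + 1 below. *)
pose Q := m%:R ^+ 3 * e^-1 ^+ 2 + 1.
have Q0 : 0 < Q.
  by rewrite ltr_wpDl// mulr_ge0 ?exprn_ge0// invr_ge0 ltW.
pose k := e^-1 * Q ^+ 2 * C0 + Q.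
have k_ge0 : 0 <= k.
  by rewrite addr_ge0 ?mulr_ge0 ?invr_ge0 ?exprn_ge0// ltW.
(* This h0 makes |v| <= Q |d| <= Q C0 h < e, the range of the Taylor bound. *)
exists (e / (Q * C0 + 1)), (m%:R * k + 1).
have QC0 : 0 < Q * C0 + 1 by rewrite ltr_wpDl// mulr_ge0// ltW.
split; [by rewrite divr_gt0|by rewrite ltr_wpDl// mulr_ge0|].
move=> h a b h0 hh0 Ka Kb dh.
set d := a - b in dh *; set c := midpt a b.
have Kc : K c by exact: convex_midpt.
have Uc := KU _ Kc.
have dd : `|d| <= C0 * h := le_trans (norm_le_enorm _) dh.
have [Rb Lb] := eB _ Kc.
pose sigma i := chi (eigval E i c / h) - 2^-1.
pose v := spectral_mx E c sigma *m d.
have spec_le s (B : R) : 0 <= B -> (forall i, `|s i| <= B) ->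
    `|spectral_mx E c s *m d| <= Q * B * `|d|.
  move=> B0 sB; apply: (le_trans (norm_spectral_le B0 Rb Lb sB)).
  by rewrite ler_wpM2r// ler_wpM2r// lerDl.
have vd : `|v| <= Q * `|d|.
  rewrite -[Q]mulr1; apply: spec_le => // i; exact: switch_sub_half.
have ve : `|v| < e.
  move: hh0; rewrite ler_pdivlMr// => hh0.
  apply: (le_lt_trans vd); apply: lt_le_trans hh0.
  have : Q * `|d| <= Q * (C0 * h) by rewrite ler_wpM2l// ltW.
  move=> /le_lt_trans; apply; rewrite mulrA mulrDr mulr1 [h * _]mulrC.
  by rewrite ltrDl.
have wE : upwind E chi h a b = c + v by rewrite (upwindE eigE).
have [Uw taylor] := eT _ Kc _ ve.
rewrite wE; split=> //.
have dg : differentiable g c by apply: gC2.1.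
have split_error : g (c + v) - roe_flux g E a b =
    (g (c + v) - g c - 'D_v g c) +
    spectral_mx E c (fun i => eigval E i c * sigma i - 2^-1 * `|eigval E i c|) *m d.
  rewrite -(DmxE v dg) /v mulmxA (Dmx_spectral eigE)// /roe_flux -/c -/d.
  have -> : absmx E c = spectral_mx E c (fun i => `|eigval E i c|) by [].
  have -> : spectral_mx E c
      (fun i => eigval E i c * sigma i - 2^-1 * `|eigval E i c|) =
    spectral_mx E c (fun i => eigval E i c * sigma i) -
    2^-1 *: spectral_mx E c (fun i => `|eigval E i c|).
    rewrite /spectral_mx scalemxAl scalemxAr -mulmxBl -mulmxBr.
    congr (_ *m _ *m _); apply/matrixP => i j; rewrite !mxE.
    by case: eqVneq => [->|_]; rewrite ?mulr1n// !mulr0n mulr0 subr0.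
  by rewrite mulmxBl -scalemxAl opprD !addrA subrK.
have err : `|g (c + v) - roe_flux g E a b| <= k * h * `|d|.
  rewrite split_error (le_trans (ler_normD _ _))// 2!mulrDl lerD//; last first.
    apply: spec_le => [|i]; [exact: ltW|exact: switch_defect].
  apply: (le_trans taylor).
  rewrite [leRHS](_ : _ = e^-1 * ((Q * (C0 * h)) * (Q * `|d|))); last by ring.
  rewrite ler_wpM2l ?invr_ge0 ?(ltW e0)//.
  rewrite expr2 ler_pM// (le_trans vd)// ler_wpM2l// ltW//.
apply: (le_trans (enorm_le_norm _)); rewrite muln1 enormB -/d.
apply: (le_trans (ler_wpM2l (ler0n R m) err)).
rewrite [leRHS](_ : _ = m%:R * (k * h * enorm d) + h * enorm d); last by ring.
rewrite ler_wpDr ?mulr_ge0 ?enorm_ge0 ?(ltW h0)// ler_wpM2l// ler_wpM2l//.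
  by rewrite mulr_ge0// ltW.
exact: norm_le_enorm.
Unshelve. all: by end_near. Qed.

Lemma roe_fluxE {R : realType} {m : nat} (g : 'cV[R]_m -> 'cV[R]_m)
    (E : eigenfields R m) (chi : R -> R) (h : R) (a b : 'cV[R]_m) :
  0 < h -> a != b ->
  roe_flux g E a b =
    g (upwind E chi h a b) - h *: (roe_mu g E chi h a b *m (b - a)).
Proof.
move=> h0 ab; have d0 : 0 < enorm (a - b) by rewrite enorm_gt0// subr_eq0.
rewrite /roe_mu tensorE (enormB b a) !scalerA.
rewrite (_ : h * _ * _ = 1) ?scale1r ?subKr//.
by field; rewrite !gt_eqF.
Qed.

Lemma enorm_roe_mu_le {R : realType} {m : nat} (g : 'cV[R]_m -> 'cV[R]_m)
    (E : eigenfields R m) (chi : R -> R) (h C : R) (a b : 'cV[R]_m) :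
  0 < h -> a != b ->
  enorm (g (upwind E chi h a b) - roe_flux g E a b) <= C * h * enorm (b - a) ->
  enorm (roe_mu g E chi h a b) <= C.
Proof.
move=> h0 ab err; have d0 : 0 < enorm (b - a).
  by rewrite enorm_gt0// subr_eq0 eq_sym.
rewrite /roe_mu enorm_tensor enormZ (enormB a b) ger0_norm; last first.
  by rewrite invr_ge0 mulr_ge0 ?sqr_ge0 ?ltW.
move: err; move: (enorm (g _ - _)) => x err.
rewrite (_ : _ * _ = x / (h * enorm (b - a))); last by field; rewrite !gt_eqF.
by rewrite ler_pdivrMr ?mulr_gt0// mulrA.
Qed.

Theorem mainTheorem6 (R : realType) (m : nat)
    (U : set 'cV[R]_m) (g : 'cV[R]_m -> 'cV[R]_m) (K : set 'cV[R]_m)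
    (E : eigenfields R m) (chi : R -> R)
    (openU : open U) (gC2 : Ck_on 2 U g)
    (hypg : strictly_hyperbolic U g)
    (KU : K `<=` U) (convK : convex_set K) (compK : compact K)
    (eigE : eigenfields_of U g E) (chiP : smooth_switch chi) :
  forall C0 : R, 0 < C0 ->
  exists h0 C : R, [/\ 0 < h0, 0 < C,
    (forall (h : R) (a b : 'cV[R]_m),
       0 < h -> h <= h0 -> K a -> K b -> enorm (a - b) <= C0 * h ->
       U (upwind E chi h a b) /\
       enorm (g (upwind E chi h a b) - roe_flux g E a b)
         <= C * h * enorm (b - a)) &
    exists2 muK : R, 0 < muK &
      forall (h : R) (a b : 'cV[R]_m),
        0 < h -> h <= h0 -> K a -> K b -> a != b ->
        enorm (a - b) <= C0 * h ->
        roe_flux g E a b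
          = g (upwind E chi h a b) - h *: (roe_mu g E chi h a b *m (b - a)) /\
        enorm (roe_mu g E chi h a b) <= muK * (1 + enorm (b - a) / h)].
Proof.
move=> C0 C0_gt0.
have [h0 [C [h0_gt0 C_gt0 err]]] :=
  upwind_error openU gC2 KU convK compK eigE chiP C0 C0_gt0.
exists h0, C; split=> //; exists C => // h a b h_gt0 hh0 Ka Kb ab dh.
split; first exact: roe_fluxE.
have [_ /(enorm_roe_mu_le _ _ _ _ _ _ _ h_gt0 ab) muC] := err h a b h_gt0 hh0 Ka Kb dh.
apply: (le_trans muC); rewrite ler_peMr ?(ltW C_gt0)//.
by rewrite lerDl divr_ge0 ?enorm_ge0 ?ltW.
Qed.
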